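(* Let $K>1$, $\theta\in(-\pi/2,\pi/2]$ and $H(z)=h_{K,\theta}(z)^2$. Then $\mathbb{C}=I(H)\cup\partial I(H)\cup\mathcal{A}(0)$, where $\mathcal{A}(0)$ is the basin of attraction of the fixed point $0$ of $H$.
   Context: $h_{K,\theta}(z)=\frac{K+1}{2}z+e^{2i\theta}\frac{K-1}{2}\overline{z}$. $I(H)=\{z\in\mathbb{C}:|H^n(z)|\to\infty\text{ as }n\to\infty\}$ is the escaping set, $\partial I(H)$ its boundary in $\mathbb{C}$, and $\mathcal{A}(0)=\{z\in\mathbb{C}:H^n(z)\to0\text{ as }n\to\infty\}$. *)

(* Defs.v *)
From Stdlib Require Import Reals.
From Coquelicot Require Import Coquelicot.
Open Scope R_scope.

(* Coquelicot has no complex exponential. *)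
Definition Cexp (z : C) : C :=
  (exp (fst z) * cos (snd z), exp (fst z) * sin (snd z)).

Definition stretch (K theta : R) (z : C) : C :=
  (RtoC ((K + 1) / 2) * z
   + Cexp (RtoC 2 * Ci * RtoC theta) * RtoC ((K - 1) / 2) * Cconj z)%C.

Definition quasi_square (K theta : R) (z : C) : C :=
  (stretch K theta z ^ 2)%C.

Definition escaping_set (f : C -> C) (z : C) : Prop :=
  is_lim_seq (fun n : nat => Cmod (Nat.iter n f z)) p_infty.

Definition basin (f : C -> C) (p z : C) : Prop :=
  filterlim (fun n : nat => Nat.iter n f z) eventually
    (@locally C_UniformSpace p).

Definition closure (S : C -> Prop) (z : C) : Prop :=
  forall U : C -> Prop, @locally C_UniformSpace z U -> exists w : C, U w /\ S w.

Definition interior (S : C -> Prop) (z : C) : Prop :=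
  @locally C_UniformSpace z S.

Definition boundary (S : C -> Prop) (z : C) : Prop :=
  closure S z /\ ~ interior S z.

Lemma quasi_square_fixed_0 (K theta : R) :
  quasi_square K theta (RtoC 0) = RtoC 0.
Proof.
unfold quasi_square, stretch.
replace (Cconj (RtoC 0)) with (RtoC 0).
- simpl; ring.
- unfold Cconj, RtoC; simpl; f_equal; ring.
Qed.

(* Main.v *)
Require Import Defs.
From Stdlib Require Import Reals Lra Lia Classical.
From Coquelicot Require Import Coquelicot.

(** Two features of [quasi_square K theta] carry the theorem.  It is
    homogeneous of degree two along rays, H (t z) = t^2 H (z) for real t,
    whence H^n (t z) = t^(2^n) H^n (z) ([iter_homogeneous]).  And since the
    real-linear map [stretch K theta] never shortens a vector
    ([Cmod_stretch_ge]), we have |H (z)| >= |z|^2, so that an orbit which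
    leaves the closed unit disc escapes ([escaping_of_iter_gt_1]).

    Let z be outside the escaping set and its boundary.  Then a neighbourhood
    of z misses the escaping set; it contains a point t z with t > 1, whose
    whole orbit lies in the closed unit disc.  Homogeneity turns this bound
    into |H^n (z)| <= t^(-2^n), and the orbit of z tends to 0.  Thus each ray
    consists of a segment of the basin, then at most one other non-escaping
    point, then escaping points only. *)

Lemma is_lim_seq_pow_pow2 (q : R) :
  1 < q -> is_lim_seq (fun n => q ^ (2 ^ n)) p_infty.
Proof.
intros Hq.
apply is_lim_seq_le_p_loc with (fun n => q ^ n).
- exists 0%nat; intros n _.
  apply Rle_pow; [lra|].
  apply Nat.lt_le_incl, Nat.pow_gt_lin_r; lia.
- now apply is_lim_seq_geom_p.
Qed.

Lemma pow_pow2_succ (x : R) (n : nat) : x ^ (2 ^ S n) = (x ^ (2 ^ n)) ^ 2.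
Proof. now rewrite <- pow_mult, Nat.mul_comm, <- Nat.pow_succ_r'. Qed.

Lemma iter_Cmod_ge (f : C -> C) :
  (forall z, Cmod z ^ 2 <= Cmod (f z)) ->
  forall n z, Cmod z ^ (2 ^ n) <= Cmod (Nat.iter n f z).
Proof.
intros Hf n z; induction n as [|n IH].
- simpl; lra.
- rewrite pow_pow2_succ; cbn [Nat.iter nat_rect].
  apply Rle_trans with (2 := Hf _).
  apply pow_incr; split; [apply pow_le, Cmod_ge_0 | exact IH].
Qed.

Lemma iter_homogeneous (f : C -> C) :
  (forall (t : R) z, f (RtoC t * z)%C = (RtoC (t ^ 2) * f z)%C) ->
  forall n (t : R) z,
    Nat.iter n f (RtoC t * z)%C = (RtoC (t ^ (2 ^ n)) * Nat.iter n f z)%C.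
Proof.
intros Hf n t z; induction n as [|n IH].
- simpl; now rewrite Rmult_1_r.
- rewrite pow_pow2_succ; cbn [Nat.iter nat_rect].
  unfold Nat.iter in IH; rewrite IH; apply Hf.
Qed.

(** Once the modulus exceeds 1 it is squared, at least, at every further
    step, so it grows doubly exponentially. *)
Lemma escaping_of_iter_gt_1 (f : C -> C) :
  (forall z, Cmod z ^ 2 <= Cmod (f z)) ->
  forall k z, 1 < Cmod (Nat.iter k f z) -> escaping_set f z.
Proof.
intros Hf k z Hk.
unfold escaping_set.
apply is_lim_seq_incr_n with k.
apply is_lim_seq_le_p_loc with (2 := is_lim_seq_pow_pow2 _ Hk).
exists 0%nat; intros n _.
rewrite Nat.iter_add; now apply iter_Cmod_ge.
Qed.

Lemma locally_dilate (z : C) (U : C -> Prop) :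
  @locally C_UniformSpace z U -> exists t : R, 1 < t /\ U (RtoC t * z)%C.
Proof.
intros [eps Heps].
pose proof (cond_pos eps) as He.
pose proof (Cmod_ge_0 z) as Hz.
(* The added 1 keeps the denominator positive when z = 0. *)
set (d := eps / (Cmod z + 1)).
assert (Hd : 0 < d) by (apply Rdiv_lt_0_compat; lra).
assert (Hdz : d * Cmod z < eps).
{ replace (pos eps) with (d * (Cmod z + 1)) by (unfold d; field; lra).
  apply Rmult_lt_compat_l; lra. }
exists (1 + d); split; [lra|].
apply Heps.
pose proof (Rmax_Cmod z) as Hm.
pose proof (Rmax_l (Rabs (fst z)) (Rabs (snd z))) as H1.
pose proof (Rmax_r (Rabs (fst z)) (Rabs (snd z))) as H2.
assert (Hc : forall x, Rabs x <= Cmod z -> Rabs (d * x) < eps).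
{ intros x Hx; rewrite Rabs_mult, (Rabs_pos_eq d) by lra.
  apply Rle_lt_trans with (2 := Hdz), Rmult_le_compat_l; lra. }
split; unfold ball; simpl; unfold AbsRing_ball, abs, minus, plus, opp; simpl.
- replace (_ + - fst z) with (d * fst z) by ring; apply Hc; lra.
- replace (_ + - snd z) with (d * snd z) by ring; apply Hc; lra.
Qed.

Lemma basin_0_of_Cmod (f : C -> C) (z : C) :
  is_lim_seq (fun n => Cmod (Nat.iter n f z)) 0 -> basin f (RtoC 0) z.
Proof.
intros H.
exact (@filterlim_norm_zero nat C_AbsRing C_NormedModule eventually _
         (fun n => Nat.iter n f z) H).
Qed.

(** The factor t between z and its dilate becomes t^(2^n) after n steps, so a
    bound on the orbit of the outer point forces the inner orbit to 0. *)
Lemma basin_0_of_bounded_dilate (f : C -> C) :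
  (forall (t : R) z, f (RtoC t * z)%C = (RtoC (t ^ 2) * f z)%C) ->
  forall (t : R) z, 1 < t ->
  (forall n, Cmod (Nat.iter n f (RtoC t * z)%C) <= 1) ->
  basin f (RtoC 0) z.
Proof.
intros Hf t z Ht Hb.
apply basin_0_of_Cmod.
apply is_lim_seq_le_le with (fun _ => 0) (fun n => / t ^ (2 ^ n)).
- intros n; split; [apply Cmod_ge_0|].
  assert (Hp : 0 < t ^ (2 ^ n)) by (apply pow_lt; lra).
  specialize (Hb n).
  rewrite iter_homogeneous, Cmod_mult, Cmod_R, Rabs_pos_eq in Hb
    by (trivial; lra).
  apply Rmult_le_reg_l with (1 := Hp).
  rewrite Rinv_r by lra; exact Hb.
- apply is_lim_seq_const.
- replace (Finite 0) with (Rbar_inv p_infty) by reflexivity.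
  apply is_lim_seq_inv; [now apply is_lim_seq_pow_pow2 | discriminate].
Qed.

Lemma escaping_boundary_basin (f : C -> C) :
  (forall (t : R) z, f (RtoC t * z)%C = (RtoC (t ^ 2) * f z)%C) ->
  (forall z, Cmod z ^ 2 <= Cmod (f z)) ->
  forall z,
    escaping_set f z \/ boundary (escaping_set f) z \/ basin f (RtoC 0) z.
Proof.
intros Hhom Hge z.
destruct (classic (escaping_set f z)) as [He|He]; [now left|right].
destruct (classic (closure (escaping_set f) z)) as [Hc|Hc].
- left; split; [exact Hc|].
  intros Hi; exact (He (locally_singleton _ _ Hi)).
- right.
  apply not_all_ex_not in Hc; destruct Hc as [U HU].
  apply imply_to_and in HU; destruct HU as [HzU HU].
  destruct (locally_dilate z U HzU) as [t [Ht HtU]].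
  apply basin_0_of_bounded_dilate with t; trivial.
  intros n; apply Rnot_lt_le; intros Hn.
  apply HU; exists (RtoC t * z)%C; split; [exact HtU|].
  now apply escaping_of_iter_gt_1 with n.
Qed.

Lemma Cmod_Cexp (z : C) : Cmod (Cexp z) = exp (Re z).
Proof.
unfold Cexp, Cmod, Re; simpl fst; simpl snd.
rewrite <- (sqrt_pow2 (exp (fst z))) by apply Rlt_le, exp_pos.
f_equal.
pose proof (sin2_cos2 (snd z)) as H; unfold Rsqr in H.
rewrite sqrt_pow2 by apply Rlt_le, exp_pos.
transitivity (exp (fst z) ^ 2 *
  (sin (snd z) * sin (snd z) + cos (snd z) * cos (snd z))); [ring|].
rewrite H; ring.
Qed.

(** The singular values of the stretch are K and 1: it multiplies lengths by
    K in the direction exp (i theta) and by 1 in the orthogonal one.  The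
    reverse triangle inequality sees the smaller value as
    (K + 1) / 2 - (K - 1) / 2. *)
Lemma Cmod_stretch_ge (K theta : R) (z : C) :
  1 <= K -> Cmod z <= Cmod (stretch K theta z).
Proof.
intros HK.
unfold stretch.
set (a := (RtoC ((K + 1) / 2) * z)%C).
set (b := (Cexp (RtoC 2 * Ci * RtoC theta) * RtoC ((K - 1) / 2) * Cconj z)%C).
assert (Ha : Cmod a = (K + 1) / 2 * Cmod z).
{ unfold a; rewrite Cmod_mult, Cmod_R, Rabs_pos_eq; lra. }
assert (Hb : Cmod b = (K - 1) / 2 * Cmod z).
{ unfold b; rewrite !Cmod_mult, Cmod_Cexp, Cmod_R, Cmod_conj, Rabs_pos_eq by lra.
  replace (Re (RtoC 2 * Ci * RtoC theta)%C) with 0 by (simpl; ring).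
  rewrite exp_0; ring. }
pose proof (Cmod_triangle (a + b) (- b)) as Ht.
replace (a + b + - b)%C with a in Ht by ring.
rewrite Cmod_opp in Ht.
lra.
Qed.

Lemma stretch_homogeneous (K theta t : R) (z : C) :
  stretch K theta (RtoC t * z)%C = (RtoC t * stretch K theta z)%C.
Proof.
unfold stretch.
replace (Cconj (RtoC t * z)%C) with (RtoC t * Cconj z)%C; [ring|].
unfold Cconj, Cmult; simpl; f_equal; ring.
Qed.

Theorem corollary2p7 :
  forall K theta : R, 1 < K -> - PI / 2 < theta <= PI / 2 ->
  forall z : C,
    escaping_set (quasi_square K theta) z \/
    boundary (escaping_set (quasi_square K theta)) z \/
    basin (quasi_square K theta) (RtoC 0) z.
Proof.
intros K theta HK _.
apply escaping_boundary_basin; intros; unfold quasi_square.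
- rewrite stretch_homogeneous, RtoC_pow; simpl; ring.
- rewrite Cmod_pow.
  apply pow_incr; split; [apply Cmod_ge_0 | apply Cmod_stretch_ge; lra].
Qed.
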